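(* Let $k\geq1$ and $N\geq1$ be integers. Define $\psi(4k+1)=N$ and, for $4k+1<n\leq4k+9$ successively, let $\psi(n)$ be the smallest integer $y>\psi(n-1)$ with $t(y)=t(n)$. Then $\psi(4k+9)\leq N+16$.
   Context: $t(m)\in\{0,1\}$ is the parity of the number of ones in the binary expansion of $m$. *)

(* Defs.v *)
From mathcomp Require Import all_boot.

Set Implicit Arguments.
Unset Strict Implicit.
Unset Printing Implicit Defensive.

(* The i-th binary digit of m is (m %/ 2 ^ i) %% 2; since m < 2 ^ m, the
   digits of index i < m include all the nonzero ones. *)
Definition ones (m : nat) : nat := \sum_(i < m) ((m %/ 2 ^ i) %% 2).

Definition t (m : nat) : nat := ones m %% 2.

Lemma ones_doubleS (a : nat) : ones (a.*2.+1) = (ones a.*2).+1.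
Proof.
have e : ones a.*2 = \sum_(i < a.*2.+1) (a.*2 %/ 2 ^ i) %% 2.
  have z : a.*2 %/ 2 ^ a.*2 = 0 by apply: divn_small; apply: ltn_expl.
  by rewrite big_ord_recr /= z mod0n addn0.
rewrite e {e}.
rewrite /ones big_ord_recl [in RHS]big_ord_recl expn0 !divn1 !modn2 /=.
rewrite odd_double add0n add1n; congr _.+1; apply: eq_bigr => i _.
by rewrite /bump /= add1n expnS 2!divnMA !divn2 /= uphalf_double doubleK.
Qed.

Lemma t_doubleS (a : nat) : t a.*2.+1 = 1 - t a.*2.
Proof. by rewrite /t ones_doubleS !modn2 /=; case: odd. Qed.

Lemma ex_next (n x : nat) : exists y, (x < y) && (t y == t n).
Proof.
have lt_x : x < x.+1.*2 by rewrite -addnn addSn ltnS leq_addr.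
have [e|ne] := eqVneq (t x.+1.*2) (t n).
  by exists x.+1.*2; rewrite lt_x e eqxx.
exists x.+1.*2.+1; rewrite (ltn_trans lt_x) //= t_doubleS.
by move: ne; rewrite /t !modn2; case: odd; case: odd.
Qed.

Definition next_t (n x : nat) : nat := ex_minn (ex_next n x).

(* Main.v *)
Require Import Defs.
From mathcomp Require Import all_boot.

(** Each step of [psi] takes the first available position, so [psi (4k+9) <= N+16]
    as soon as the word [t(4k+2) ... t(4k+9)] is a scattered subword of
    [t(N+1) ... t(N+16)].  Since [t] is fixed by the Thue-Morse morphism
    [b |-> b (1-b)], with [k = 2j+s] and [N = 16q+r] the first word is a factor of
    the third image of [t(j) t(j+1)] and the second one a factor of the fourth
    image of [t(q) t(q+1)], which leaves finitely many cases. *)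

(** Digits of index at least [m] vanish because [m < 2 ^ m]; this allows digit sums of different
    numbers to be compared over a common range. *)
Lemma ones_widen (m n : nat) :
  m <= n -> ones m = \sum_(i < n) ((m %/ 2 ^ i) %% 2).
Proof.
move=> le_mn; rewrite /ones (big_ord_widen n (fun i => (m %/ 2 ^ i) %% 2) le_mn).
rewrite [RHS](bigID (fun i : 'I_n => i < m)) /= [X in _ = _ + X]big1 ?addn0 //.
move=> i; rewrite -leqNgt => le_mi; rewrite divn_small ?mod0n //.
exact: leq_ltn_trans le_mi (ltn_expl _ _).
Qed.

Lemma ones_double (a : nat) : ones a.*2 = ones a.
Proof.
have le_2a : a.*2 <= a.*2.+1 by [].
have le_a : a <= a.*2 by rewrite -addnn leq_addr.
rewrite (ones_widen _ _ le_2a) (ones_widen _ _ le_a) big_ord_recl /=.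
rewrite expn0 divn1 modn2 odd_double add0n; apply: eq_bigr => i _.
by rewrite /bump /= add1n expnS divnMA divn2 doubleK.
Qed.

Definition tbit (m : nat) : bool := odd (ones m).

Lemma t_tbit (m : nat) : t m = tbit m.
Proof. by rewrite /t modn2. Qed.

Definition thue_morse (s : seq bool) : seq bool :=
  flatten [seq [:: b; ~~ b] | b <- s].

Lemma thue_morse_tbit (m n : nat) :
  [seq tbit i | i <- iota m.*2 n.*2] = thue_morse [seq tbit i | i <- iota m n].
Proof.
elim: n m => [|n IHn] m //; rewrite doubleS /= -doubleS IHn.
by rewrite /tbit ones_doubleS ones_double.
Qed.

Lemma iter_thue_morse_tbit (e m n : nat) :
  [seq tbit i | i <- iota (2 ^ e * m) (2 ^ e * n)] =
  iter e thue_morse [seq tbit i | i <- iota m n].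
Proof.
elim: e => [|e IHe]; first by rewrite !mul1n.
by rewrite iterS -IHe -thue_morse_tbit -!mul2n !mulnA -!expnS.
Qed.

(** The bound on [d + l] keeps the window inside two consecutive blocks of length [2 ^ e], the
    images of the letters at [m] and [m.+1]. *)
Lemma tbit_factor (e m d l : nat) : d + l <= 2 ^ e * 2 ->
  [seq tbit i | i <- iota (2 ^ e * m + d) l] =
  take l (drop d (iter e thue_morse [:: tbit m; tbit m.+1])).
Proof.
move=> le_dl; rewrite -[[:: _; _]]/[seq tbit i | i <- iota m 2].
rewrite -iter_thue_morse_tbit -map_drop -map_take drop_iota take_iota addnC.
congr map; congr iota; apply/esym/minn_idPl.
by rewrite leq_subRL // (leq_trans (leq_addr l d)).
Qed.

Definition greedy (ns : seq nat) (x : nat) : nat :=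
  foldl (fun y n => next_t n y) x ns.

Lemma next_t_hit (n x : nat) : t x.+1 = t n -> next_t n x = x.+1.
Proof.
move=> e; rewrite /next_t; case: ex_minnP => y /andP[lt_xy _] min_y.
by apply/eqP; rewrite eqn_leq lt_xy andbT min_y // ltnSn e /=.
Qed.

(** Both sides are the least element of the same set, since [x.+1] is not a candidate. *)
Lemma next_t_miss (n x : nat) : t x.+1 != t n -> next_t n x = next_t n x.+1.
Proof.
move=> ne; rewrite /next_t; case: ex_minnP => y /andP[lt_xy ty] min_y.
case: ex_minnP => z /andP[lt_xz tz] min_z; apply/eqP; rewrite eqn_leq.
rewrite min_y ?tz ?(ltnW lt_xz) // min_z // ty andbT ltn_neqAle lt_xy andbT.
by apply: contraNneq ne => ->.
Qed.

(** [subseq] itself matches letters leftmost first: its two branches are exactly [next_t_hit] and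
    [next_t_miss], so induction on the window length follows both in parallel. *)
Lemma greedy_le (ns : seq nat) (x l : nat) :
  subseq [seq t n | n <- ns] [seq t y | y <- iota x.+1 l] ->
  greedy ns x <= x + l.
Proof.
elim: l ns x => [|l IHl] [|n ns] x //=; rewrite ?leq_addr //.
rewrite addnS -addSn; case: eqP => [e|/eqP ne] sub.
  by rewrite next_t_hit //; apply: IHl.
by rewrite next_t_miss 1?eq_sym //; apply: (IHl (n :: ns)).
Qed.

Lemma greedy_iota (psi : nat -> nat) (m l : nat) :
  (forall n, m < n <= m + l -> psi n = next_t n (psi (n - 1))) ->
  psi (m + l) = greedy (iota m.+1 l) (psi m).
Proof.
elim: l => [|l IHl] step; first by rewrite addn0.
(* The last index is split off, because [foldl] applies it last. *)
rewrite -[X in iota _ X]addn1 iotaD /greedy foldl_cat.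
rewrite -/(greedy (iota m.+1 l) (psi m)) -IHl; last first.
  move=> n /andP[lt_mn le_n]; apply: step.
  by rewrite lt_mn addnS (leq_trans le_n).
by rewrite step ?addnS ?subn1 ?addSn //= !ltnS leq_addr leqnn.
Qed.

Lemma thue_morse_window (a b c d : bool) (s r : nat) : s < 2 -> r < 16 ->
  subseq (take 8 (drop (4 * s + 2) (iter 3 thue_morse [:: a; b])))
         (take 16 (drop r.+1 (iter 4 thue_morse [:: c; d]))).
Proof.
move=> lt_s lt_r.
(* Bounded quantifiers become boolean [all], so that each of the 16 choices of letters is settled by
   evaluating 32 pairs of offsets. *)
have : all (fun s => all (fun r =>
    subseq (take 8 (drop (4 * s + 2) (iter 3 thue_morse [:: a; b])))
           (take 16 (drop r.+1 (iter 4 thue_morse [:: c; d]))))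
  (iota 0 16)) (iota 0 2) by case: a; case: b; case: c; case: d; vm_compute.
by move/allP/(_ s); rewrite mem_iota => /(_ lt_s)/allP/(_ r); rewrite mem_iota; apply.
Qed.

Theorem theorem5 (k N : nat) (psi : nat -> nat)
  (hk : 1 <= k) (hN : 1 <= N)
  (psi_start : psi (4 * k + 1) = N)
  (psi_step : forall n : nat, 4 * k + 1 < n <= 4 * k + 9 ->
     psi n = next_t n (psi (n - 1))) :
  psi (4 * k + 9) <= N + 16.
Proof.
rewrite -[9]/(1 + 8) addnA greedy_iota ?psi_start; last first.
  by move=> n; rewrite -addnA; apply: psi_step.
apply: greedy_le; rewrite !(eq_map t_tbit) !(map_comp nat_of_bool tbit).
apply: map_subseq.
(* Dividing [N] rather than [N.+1] gives an offset from 1 to 16, so 16 further letters still fit in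
   two blocks of length 16. *)
have eN : N.+1 = 2 ^ 4 * (N %/ 16) + (N %% 16).+1.
  by rewrite addnS mulnC -divn_eq.
have ek : (4 * k + 1).+1 = 2 ^ 3 * (k %/ 2) + (4 * (k %% 2) + 2).
  by rewrite {1}(divn_eq k 2) mulnDr (mulnC _ 2) mulnA addn1 addn2 !addnS.
have lt_s : k %% 2 < 2 by rewrite ltn_mod.
have lt_r : N %% 16 < 16 by rewrite ltn_mod.
rewrite eN ek !tbit_factor.
- exact: thue_morse_window.
- by rewrite -[2 ^ 4 * 2]/(16 + 16) leq_add2r.
- by case: (k %% 2) lt_s => [|[]].
Qed.
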